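(* Let $n \geq 4$ and let $n_1, n_2 \geq 2$ be integers with $2n - 1 = n_1 + n_2$. Then the augmented cube $AQ_n$ can be decomposed into two spanning subgraphs $H_1$ and $H_2$ such that, for each $i\in\{1,2\}$, $H_i$ is $n_i$-regular and $n_i$-connected. Moreover, for each $i\in\{1,2\}$, $H_i$ is $4$-pancyclic if $n_i \geq 3$.
   Context: The augmented cube $AQ_n$ ($n\ge 1$) is a simple graph with vertex set $\{0,1\}^n$ (binary strings of length $n$), defined recursively: $AQ_1 = K_2$ on $\{0,1\}$. For $n \geq 2$, $AQ_n$ is obtained from two copies $AQ_{n-1}^0$ and $AQ_{n-1}^1$ of $AQ_{n-1}$ (whose vertices are prefixed by $0$ and $1$ respectively) by adding, between the copies, the edges joining $0x_1\dots x_{n-1}$ to $1y_1\dots y_{n-1}$ whenever either $y_i = x_i$ for all $i$, or $y_i = \overline{x_i}$ (the complementary bit) for all $i$. The graph $AQ_n$ is $(2n-1)$-regular on $2^n$ vertices for $n\ge 2$. A decomposition of a graph $G$ into subgraphs $H_1,\dots,H_k$ means that every edge of $G$ belongs to $H_i$ for exactly one $i$. A graph is $k$-connected if it has more than $k$ vertices and deleting any set of fewer than $k$ vertices leaves a connected graph. A graph $G$ is $r$-pancyclic if it contains a cycle of every length from $r$ to $|V(G)|$. *)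

(* Defs.v *)
From mathcomp Require Import all_boot.

Set Implicit Arguments.
Unset Strict Implicit.
Unset Printing Implicit Defensive.

(* Simple graphs with vertex set the whole finite type T.  Since every graph
   on T has all of T as its vertices, subgraphs on T are spanning. *)
Record sgraph (T : finType) := SGraph {
  edge :> rel T;
  edge_sym : symmetric edge;
  edge_irrefl : irreflexive edge
}.

Section Graphs.
Variable T : finType.
Implicit Types (G H : sgraph T) (A S : {set T}) (d k r l : nat).

Definition spanning_subgraph H G := subrel H G.

Definition decomposition2 G H1 H2 :=
  [/\ spanning_subgraph H1 G, spanning_subgraph H2 G
    & forall x y, G x y -> H1 x y (+) H2 x y].

Definition regular d G := forall x, #|[set y | G x y]| = d.

(* Connectedness of the subgraph of G induced by A.  It holds vacuously for the
   empty set, a case excluded in k_connected by the bound on #|T|. *)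
Definition connected_in G A :=
  {in A &, forall x y,
    connect [rel u v | [&& u \in A, v \in A & G u v]] x y}.

Definition k_connected k G :=
  k < #|T| /\ forall S, #|S| < k -> connected_in G (~: S).

(* ucycle alone also accepts an edge traversed back and forth as a cycle of
   length 2, as well as the empty sequence. *)
Definition has_cycle G l := 3 <= l /\ exists2 c, ucycle G c & size c = l.

Definition pancyclic r G := forall l, r <= l <= #|T| -> has_cycle G l.

End Graphs.

(* The value at n = 0 is junk: the augmented cube is defined for n >= 1. *)
Fixpoint AQ_rel (n : nat) : rel (n.-tuple bool) :=
  match n return rel (n.-tuple bool) with
  | 0 => fun _ _ => false
  | m.+1 => fun x y =>
      if m is 0 then x != y
      else if thead x == thead y then
        @AQ_rel m (behead_tuple x) (behead_tuple y)
      else (behead_tuple y == behead_tuple x)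
        || (behead_tuple y == map_tuple negb (behead_tuple x))
  end.

Lemma AQ_sym n : symmetric (@AQ_rel n).
Proof.
elim: n => [|[|n] IHn] //= x y; first by rewrite eq_sym.
rewrite [thead y == _]eq_sym; case: ifP => _; first exact: IHn.
congr orb; first by rewrite eq_sym.
have negtK : involutive (fun t : n.+1.-tuple bool => map_tuple negb t).
  by move=> t; apply/val_inj; rewrite /= -map_comp map_id_in // => b _ /=; case: b.
by rewrite -(inj_eq (inv_inj negtK)) negtK eq_sym.
Qed.

Lemma AQ_irrefl n : irreflexive (@AQ_rel n).
Proof.
by elim: n => [|[|n] IHn] //= x; rewrite eqxx //; exact: IHn.
Qed.

Definition AQ (n : nat) : sgraph (n.-tuple bool) :=
  SGraph (@AQ_sym n) (@AQ_irrefl n).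

(* Main.v *)
Require Import Defs.
From mathcomp Require Import all_boot zify.

Set Implicit Arguments.
Unset Strict Implicit.
Unset Printing Implicit Defensive.

(* AQ_(n+1) is two copies of AQ_n joined by two perfect matchings, x ~ x and
   x ~ complement of x.  Joining two copies of H_1 by the first matching and
   two copies of H_2 by the second turns a decomposition of AQ_n of type
   (n_1, n_2) into one of AQ_(n+1) of type (n_1 + 1, n_2 + 1), and each
   connectivity grows by one.  So only the types (2, 2n-3) and (3, 2n-4) have
   to be built directly.

   For (2, 2n-3), a Hamiltonian cycle C of AQ_n is reflected as in the Gray
   code: one copy of C, traversed forwards, then one copy backwards.  The
   complement of the new cycle contains two copies of the complement of C, the
   whole complementation matching, and all but two edges of the other matching;
   this is enough to raise its connectivity by two, so a computation in AQ_3
   starts the induction.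

   For (3, 2n-4), joining C to itself would give a bipartite prism.  Instead
   C = a b c d r is joined to the Hamiltonian cycle C' = a c b d r: following
   C from a to d and returning along C', or vice versa, shifts parities, and
   this yields cycles of all lengths.

   Pancyclicity is propagated through an edge x y such that there are paths
   from x to y with l vertices for every l in the upper half: paths in the two
   copies are closed up by two matching edges.  For the complementation
   matching the edge {x, complement of x} is used, which that matching maps to
   itself. *)

#[local] Arguments edge : simpl never.

(** * Paths, cycles and complements *)

Section GraphLemmas.
Variable T : finType.
Implicit Types (G H : sgraph T) (S : {set T}) (s p : seq T).

Lemma connect_homo (T' : finType) (e : rel T) (e' : rel T') (f : T -> T') x y :
  (forall u v, e u v -> connect e' (f u) (f v)) ->
  connect e x y -> connect e' (f x) (f y).
Proof.
move=> he /connectP[p]; elim: p x => [|z p IHp] x /=; first by move=> _ ->.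
by case/andP=> /he xz zp lastp; apply: connect_trans xz (IHp _ zp lastp).
Qed.

Lemma avoid_sym G S :
  connect_sym [rel u v | [&& u \in ~: S, v \in ~: S & G u v]].
Proof.
by apply: sym_connect_sym => u v /=; rewrite andbCA edge_sym.
Qed.

(** [l] counts vertices, so a path whose ends are adjacent closes up to a cycle of length [l]. *)
Definition spath G x y l :=
  exists p, [/\ path G x p, last x p = y, uniq (x :: p) & size (x :: p) = l].

Lemma spath_mono G H x y l : subrel G H -> spath G x y l -> spath H x y l.
Proof.
by move=> GH [p [xp ? ? ?]]; exists p; split=> //; apply: sub_path xp.
Qed.

Lemma spath_edge G x y : G x y -> spath G x y 2.
Proof.
move=> xy; exists [:: y]; split=> //=; first by rewrite xy.
by rewrite inE andbT; apply: contraTneq xy => ->; rewrite edge_irrefl.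
Qed.

Lemma spath_sym G x y l : spath G x y l -> spath G y x l.
Proof.
move=> [p [xp lastp Up <-]]; exists (rev (belast x p)); split.
- by rewrite -lastp rev_path (eq_path (e' := G)) // => u v; rewrite edge_sym.
- by case: (p) lastp => //= z q _; rewrite rev_cons last_rcons.
- by rewrite -lastp -rev_rcons -lastI rev_uniq.
- by rewrite /= size_rev size_belast.
Qed.

Lemma spath_cycle G x y l : G x y -> 3 <= l -> spath G x y l -> has_cycle G l.
Proof.
move=> xy l3 [p [xp lastp Up sizep]]; split=> //; exists (x :: p) => //.
by rewrite /ucycle /= rcons_path xp lastp edge_sym xy -cons_uniq Up.
Qed.

Lemma pancyclic_mono k G H : subrel G H -> pancyclic k G -> pancyclic k H.
Proof.
move=> GH panG l /panG[l3 [c /andP[cG Uc] sizec]]; split=> //; exists c => //.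
by apply/andP; split; first exact: sub_cycle cG.
Qed.

(** The upper half is what doubling calls for: in a joined graph the lengths up to half of the
    vertices already occur inside one copy, and longer cycles come from paths running through
    both. *)
Definition long_paths G x y :=
  G x y /\ forall l, #|T| < l.*2 -> l <= #|T| -> spath G x y l.

Lemma long_paths_mono G H x y :
  subrel G H -> long_paths G x y -> long_paths H x y.
Proof.
move=> GH [/GH xy long]; split=> // l ? ?.
by apply: spath_mono GH _; apply: long.
Qed.

Lemma long_paths_sym G x y : long_paths G x y -> long_paths G y x.
Proof.
move=> [xy long]; split=> [|l ? ?]; first by rewrite edge_sym.
by apply: spath_sym; apply: long.
Qed.

Definition diffG_rel G H := [rel x y | G x y && ~~ H x y].

Lemma diffG_sym G H : symmetric (diffG_rel G H).
Proof. by move=> x y /=; rewrite edge_sym (edge_sym H). Qed.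

Lemma diffG_irrefl G H : irreflexive (diffG_rel G H).
Proof. by move=> x /=; rewrite edge_irrefl. Qed.

Definition diffG G H := SGraph (@diffG_sym G H) (@diffG_irrefl G H).

Lemma diffG_regular d e G H :
  spanning_subgraph H G -> regular d G -> regular e H ->
  regular (d - e) (diffG G H).
Proof.
move=> HG dG eH x; rewrite -(dG x) -(eH x).
rewrite -[#|[set y | G x y]|](cardsID [set y | H x y]).
have -> : [set y | G x y] :&: [set y | H x y] = [set y | H x y].
  apply/setP=> y; rewrite !inE andbC; apply: andb_idr; exact: HG.
have -> : [set y | G x y] :\: [set y | H x y] = [set y | diffG G H x y].
  by apply/setP=> y; rewrite !inE andbC.
by rewrite addKn.
Qed.

Lemma diffG_decomposition G H :
  spanning_subgraph H G -> decomposition2 G H (diffG G H).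
Proof.
move=> HG; split=> // [x y /andP[] //|x y xy].
by rewrite {2}/edge /= xy; case: (H x y).
Qed.

(* The guard is needed because next s fixes the points outside s. *)
Definition cycleG_rel s :=
  [rel x y : T | (x != y) && ((y == next s x) || (x == next s y))].

Lemma cycleG_sym s : symmetric (cycleG_rel s).
Proof. by move=> x y /=; rewrite eq_sym orbC. Qed.

Lemma cycleG_irrefl s : irreflexive (cycleG_rel s).
Proof. by move=> x /=; rewrite eqxx. Qed.

Definition cycleG s := SGraph (@cycleG_sym s) (@cycleG_irrefl s).

Lemma cycleG_sub (e : rel T) s :
  symmetric e -> cycle e s -> (forall x, x \in s) -> subrel (cycleG s) e.
Proof.
move=> e_sym es sT x y /andP[_ /orP[]/eqP->]; last rewrite e_sym;
  exact: next_cycle es (sT _).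
Qed.

Section HamiltonianCycle.
Variable s : seq T.
Hypotheses (Us : uniq s) (sT : forall x, x \in s) (s_gt2 : 2 < size s).

(** Once the cycle is rotated to start at [x], its successor stands second and its predecessor last;
    these positions differ because there are more than two entries. *)
Lemma next_prev_neq x : next s x != prev s x.
Proof.
have [i p def_s] := rot_to (sT x).
have Urot : uniq (x :: p) by rewrite -def_s rot_uniq.
rewrite -(next_rot i Us) -(prev_rot i Us) def_s.
have := s_gt2; rewrite -(size_rot i) def_s.
case: p Urot {def_s} => [|y [|z p]] // Urot _.
have := cycle_prev Urot; rewrite (cycle_path x) /= => /andP[/eqP <- _].
rewrite /= eqxx; apply: contraTneq Urot => ->.
by rewrite /= mem_last !andbF.
Qed.

Lemma cycleG_edge x y : cycleG s x y = (y \in [set next s x; prev s x]).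
Proof.
have xE : (x == next s y) = (y == prev s x).
  by apply/eqP/eqP=> ->; rewrite ?(prev_next Us) ?(next_prev Us).
rewrite !inE /edge /= xE; apply: andb_idl => /orP[]/eqP->; apply/eqP.
  move=> e; have := next_prev_neq x.
  by rewrite [in prev s x]e (prev_next Us) -e eqxx.
move=> e; have := next_prev_neq x.
by rewrite [in next s x]e (next_prev Us) -e eqxx.
Qed.

Lemma cycleG_regular : regular 2 (cycleG s).
Proof.
move=> x; have -> : [set y | cycleG s x y] = [set next s x; prev s x].
  by apply/setP=> y; rewrite inE cycleG_edge.
by rewrite cards2 next_prev_neq.
Qed.

Lemma cycleG_cycle : cycle (cycleG s) s.
Proof.
by apply: cycle_from_next => // x _; rewrite cycleG_edge !inE eqxx.
Qed.

(** Cutting the cycle at the one deleted vertex [w] leaves a path, and every survivor is reached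
    from its first vertex [y]. *)
Lemma cycleG_connected : k_connected 2 (cycleG s).
Proof.
split=> [|S]; first by rewrite (leq_trans s_gt2) // -(card_uniqP Us) max_card.
rewrite ltnS => S_le1.
have [w Sw] : exists w, S \subset [set w].
  have := S_le1; rewrite leq_eqVlt ltnS leqn0 => /orP[/cards1P[w ->]|].
    by exists w.
  rewrite cards_eq0 => /eqP->; case: s s_gt2 => // w *; exists w.
  exact: sub0set.
have [i p def_s] := rot_to (sT w).
have Up : uniq (w :: p) by rewrite -def_s rot_uniq.
have pT x : x \in w :: p by rewrite -def_s mem_rot.
have wp : path (cycleG s) w (rcons p w).
  by rewrite -/(cycle _ (w :: p)) -def_s rot_cycle cycleG_cycle.
case: p {def_s} Up pT wp => [|y p] Up pT wp.
  have sw : {subset s <= [:: w]} by move=> x _; exact: pT.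
  by have := leq_trans s_gt2 (uniq_leq_size Us sw).
set e := [rel u v | [&& u \in ~: S, v \in ~: S & cycleG s u v]].
have notS x : x != w -> x \in ~: S.
  by move=> xw; rewrite inE; apply: contra xw => /(subsetP Sw); rewrite inE.
have yw : y != w by case/andP: Up; rewrite inE negb_or eq_sym => /andP[].
have to_y x : x \in ~: S -> connect e y x.
  (* [w] itself survives when [S] is empty; it is then adjacent to [y]. *)
  move=> xS; have [xw|xw] := eqVneq x w.
    rewrite xw connect1 //= notS // -xw xS xw.
    by case/andP: wp; rewrite edge_sym.
  have := pT x; rewrite in_cons (negPf xw) /= => /path_connect; apply.
  move: wp; rewrite rcons_cons /= rcons_path => /and3P[_ yp _].
  move: Up => /andP[wyp _].
  elim: p y yp wyp {pT yw} => //= z p IHp y /andP[yz zp].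
  rewrite !inE !negb_or => /and3P[wy wz wp].
  have [yS zS] : y \notin S /\ z \notin S by rewrite -!in_setC !notS 1?eq_sym.
  rewrite IHp ?in_cons ?negb_or ?wz // ?andbT; first by rewrite yS zS.
move=> x z xS zS; apply: connect_trans (to_y z zS).
by rewrite avoid_sym to_y.
Qed.

End HamiltonianCycle.
End GraphLemmas.

(** * Joining two copies by a matching *)

Local Notation vert n := (n.-tuple bool).

(** The value [false] gives the identity and [true] the complement, so one construction covers both
    matchings. *)
Definition flip n c (x : vert n) : vert n := map_tuple (addb c) x.

Lemma flip_false n (x : vert n) : flip false x = x.
Proof. by apply: val_inj; rewrite /= map_id_in. Qed.

Lemma flipK n c : involutive (@flip n c).
Proof. by move=> x; apply: val_inj; rewrite /= mapK // => b; rewrite addKb. Qed.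

Lemma flip_true_neq n (x : vert n) : 0 < n -> flip true x != x.
Proof.
case: n x => // n; case/tupleP => b x _.
by apply/eqP=> /(congr1 val)[]; case: b.
Qed.

Lemma flip_cons n c b (x : vert n) :
  flip c (cons_tuple b x) = cons_tuple (c (+) b) (flip c x).
Proof. exact: val_inj. Qed.

Lemma behead_cons n b (x : vert n) : behead_tuple (cons_tuple b x) = x.
Proof. exact: val_inj. Qed.

Lemma cons_inj n b : injective (@cons_tuple n bool b).
Proof. by move=> x y /(congr1 val)[] /val_inj. Qed.

Lemma cons_eq n b d (x y : vert n) :
  (cons_tuple b x == cons_tuple d y) = (b == d) && (x == y).
Proof. by []. Qed.

Lemma card_vert n : #|{: vert n}| = 2 ^ n.
Proof. by rewrite card_tuple card_bool. Qed.

Section Join.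
Variables (n : nat) (c : bool) (H0 H1 : sgraph (vert n)).

Definition joinG_rel : rel (vert n.+1) := fun x y =>
  if thead x == thead y
  then (if thead x then H1 else H0) (behead_tuple x) (behead_tuple y)
  else behead_tuple y == flip c (behead_tuple x).

Lemma joinG_sym : symmetric joinG_rel.
Proof.
move=> x y; rewrite /joinG_rel [thead y == _]eq_sym.
case: eqP => [->|_]; first by rewrite edge_sym.
by rewrite [LHS]eq_sym (can2_eq (flipK c) (flipK c)).
Qed.

Lemma joinG_irrefl : irreflexive joinG_rel.
Proof. by move=> x; rewrite /joinG_rel eqxx edge_irrefl. Qed.

Definition joinG := SGraph joinG_sym joinG_irrefl.

Lemma joinG_cons b d x y : joinG (cons_tuple b x) (cons_tuple d y) =
  if b == d then (if b then H1 else H0) x y else y == flip c x.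
Proof. by rewrite /edge /= /joinG_rel !theadE !behead_cons. Qed.

Lemma joinG_regular d : regular d H0 -> regular d H1 -> regular d.+1 joinG.
Proof.
move=> H0d H1d; case/tupleP => b x; set H := if b then H1 else H0.
have Hd : #|[set y | H x y]| = d by rewrite /H; case: (b).
have -> : [set y | joinG (cons_tuple b x) y] =
    cons_tuple (~~ b) (flip c x) |: cons_tuple b @: [set y | H x y].
  apply/setP; case/tupleP => e y; rewrite !inE joinG_cons cons_eq.
  case: (eqVneq b e) => [<-|be].
    rewrite mem_imset ?inE; last exact: cons_inj.
    by rewrite /H; case: (b).
  have -> : ~~ b = e by case: (b) (e) be => [] [].
  rewrite eqxx /=; apply/esym/orb_idr => /imsetP[z _ /eqP].
  by rewrite cons_eq eq_sym (negPf be).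
rewrite cardsU1 card_imset ?Hd //; last exact: cons_inj.
by case: imsetP => // -[z _ /eqP]; rewrite cons_eq; case: (b).
Qed.

Lemma path_copy b x p : path joinG (cons_tuple b x) (map (cons_tuple b) p) =
  path (if b then H1 else H0) x p.
Proof.
by rewrite path_map; apply: eq_path => u v; rewrite /= joinG_cons eqxx.
Qed.

Lemma uniq_join (p q : seq (vert n)) :
  uniq (map (cons_tuple false) p ++ map (cons_tuple true) q) =
  uniq p && uniq q.
Proof.
rewrite cat_uniq !map_inj_uniq; try exact: cons_inj.
case: hasP => //= -[_ /mapP[x _ ->] /mapP[y _ /eqP]].
by rewrite cons_eq.
Qed.

(** Go from [x] to [y] in copy 0, cross at [y], and return in copy 1. The two ends are again
    matched, so the path can be closed. *)
Lemma spath_join x y l0 l1 :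
  spath H0 x y l0 -> spath H1 (flip c x) (flip c y) l1 ->
  spath joinG (cons_tuple false x) (cons_tuple true (flip c x)) (l0 + l1).
Proof.
move=> [p [xp lastp Up <-]] [q [xq lastq Uq <-]].
exists (map (cons_tuple false) p
  ++ map (cons_tuple true) (rev (flip c x :: q))); split.
- rewrite cat_path path_copy xp lastI rev_rcons /= path_copy.
  rewrite last_map lastp lastq joinG_cons eqxx /=.
  rewrite -{1}lastq rev_path.
  by rewrite (eq_path (e' := H1)) // => u v; rewrite edge_sym.
- by rewrite last_cat rev_cons map_rcons last_rcons.
- by rewrite -[X in uniq X]/(map _ (x :: p) ++ _) uniq_join Up rev_uniq.
- by rewrite /= size_cat !size_map size_rev.
Qed.

Lemma joinG_long x y : 1 < n -> long_paths H0 x y ->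
  long_paths H1 (flip c x) (flip c y) ->
  long_paths joinG (cons_tuple false x) (cons_tuple true (flip c x)).
Proof.
move=> n1 [xy long0] [xy' long1]; split; first by rewrite joinG_cons /=.
have [M M_gt1 cardM] : exists2 M, 1 < M & #|{: vert n}| = M.*2.
  exists (2 ^ n.-1); first by rewrite -{1}(expn0 2) ltn_exp2l //; lia.
  by rewrite card_vert -mul2n -expnS prednK // ltnW.
have two0 := spath_edge xy.
have -> : #|{: vert n.+1}| = M.*2.*2.
  by rewrite -cardM !card_vert -mul2n expnS.
move: long0 long1; rewrite cardM => long0 long1 l l_gt l_le.
(* Two upper-half lengths add up to at least [M.*2 + 2], which misses [M.*2 + 1]; the edge [x y], a
   path with two vertices, fills the gap. The remainder [l - 2] is then still above [M] because
   [1 < M]. *)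
have [l0 [l1 [-> l0P l1P]]] : exists l0 l1, [/\ l = l0 + l1,
    (l0 == 2) || (M < l0 <= M.*2) & M < l1 <= M.*2].
  have [l_small|l_big] := leqP l (M.*2 + M).
    have [l_small'|l_big'] := leqP l (M.*2 + 2).
      by exists 2, (l - 2); split; lia.
    by exists (l - M.+1), M.+1; split; lia.
  by exists (l - M.*2), M.*2; split; lia.
apply: (@spath_join _ y); last by apply: long1; lia.
case/orP: l0P => [/eqP-> //|l0P]; apply: long0; lia.
Qed.

Lemma has_cycle_copy b l : has_cycle (if b then H1 else H0) l ->
  has_cycle joinG l.
Proof.
move=> [l3 [s /andP[sG Us] size_s]]; split=> //.
exists (map (cons_tuple b) s); last by rewrite size_map.
rewrite /ucycle map_inj_uniq ?Us ?andbT; last exact: cons_inj.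
by case: s sG {Us size_s} => //= x p xp; rewrite -map_rcons path_copy.
Qed.

Lemma joinG_pancyclic x y : 1 < n -> pancyclic 4 H0 -> long_paths H0 x y ->
  long_paths H1 (flip c x) (flip c y) -> pancyclic 4 joinG.
Proof.
move=> n1 pan0 long0 long1 l /andP[l4 le_l].
have [lT|lT] := leqP l #|{: vert n}|.
  by apply: (@has_cycle_copy false); apply: pan0; rewrite l4.
have [xy long] := joinG_long n1 long0 long1.
apply: spath_cycle xy (ltnW l4) (long _ _ le_l).
by move: lT; rewrite !card_vert expnS; lia.
Qed.

End Join.

(** * Connectivity of doubled graphs *)

Definition slice n b (S : {set vert n.+1}) := [set x | cons_tuple b x \in S].

Lemma card_slices n b (S : {set vert n.+1}) :
  #|S| = #|slice b S| + #|slice (~~ b) S|.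
Proof.
have sliceE d : [set x in S | thead x == d] = cons_tuple d @: slice d S.
  apply/setP; case/tupleP => e x; rewrite inE theadE andbC.
  case: eqVneq => [->|ed]; first by rewrite mem_imset ?inE //; exact: cons_inj.
  by apply/esym/negP=> /imsetP[y _ /eqP]; rewrite cons_eq (negPf ed).
have cardE d : #|slice d S| = #|[set x in S | thead x == d]|.
  by rewrite sliceE card_imset //; exact: cons_inj.
rewrite !cardE -[LHS](cardsID [set x | thead x == b]).
have -> : S :&: [set x | thead x == b] = [set x in S | thead x == b].
  by apply/setP=> x; rewrite !inE.
suff -> : S :\: [set x | thead x == b] = [set x in S | thead x == ~~ b] by [].
by apply/setP=> x; rewrite !inE andbC; case: (thead x) (b) => [] [].
Qed.

Section Doubling.
Variables (n k : nat) (c : bool) (H : bool -> sgraph (vert n)).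
Variable G : sgraph (vert n.+1).
Hypothesis Hk : forall b, k_connected k (H b).
Hypothesis GH : forall b x y, H b x y -> G (cons_tuple b x) (cons_tuple b y).
Hypothesis Gflip :
  forall b x, G (cons_tuple b x) (cons_tuple (~~ b) (flip c x)).

Variable S : {set vert n.+1}.
Let R := [rel u v | [&& u \in ~: S, v \in ~: S & G u v]].

Lemma connect_slice b x y : #|slice b S| < k ->
  x \notin slice b S -> y \notin slice b S ->
  connect R (cons_tuple b x) (cons_tuple b y).
Proof.
move=> Sk xS yS; have [_ /(_ _ Sk x y)] := Hk b.
rewrite !in_setC => /(_ xS yS); apply: connect_homo => u v /=.
by rewrite !inE => /and3P[uS vS uv]; rewrite connect1 //= !inE uS vS GH.
Qed.

Lemma connect_cross b x :
  x \notin slice b S -> flip c x \notin slice (~~ b) S ->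
  connect R (cons_tuple b x) (cons_tuple (~~ b) (flip c x)).
Proof. by rewrite !inE => xS yS; rewrite connect1 //= !inE xS yS Gflip. Qed.

(** If both copies lose fewer than [k] vertices, both stay connected, and some matching edge
    survives since [S] is smaller than the matching. Otherwise one copy may fall apart, but by
    hypothesis each of its survivors reaches the other copy, which is still connected. *)
Lemma doubling_connected : #|S| < #|{: vert n}| ->
  (forall b, k <= #|slice b S| ->
    #|slice (~~ b) S| < k /\ forall x, x \notin slice b S ->
      exists2 y, y \notin slice (~~ b) S &
        connect R (cons_tuple b x) (cons_tuple (~~ b) y)) ->
  connected_in G (~: S).
Proof.
move=> S_lt large.
have [b [z zS all_z]] : exists b, exists2 z, z \notin slice b S &
    forall d x, x \notin slice d S ->
      connect R (cons_tuple d x) (cons_tuple b z).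
  have [/existsP[b /large[S'k attach]]|small] :=
      boolP [exists b, k <= #|slice b S|].
    have /subsetPn[z _ zS] : ~~ ([set: vert n] \subset slice (~~ b) S).
      apply: contraL S'k => /subset_leq_card; rewrite cardsT -leqNgt => le.
      by have [/ltnW/leq_trans-> //] := Hk b.
    exists (~~ b), z => // d x xS.
    have [db|db] := eqVneq d (~~ b).
      by rewrite db in xS *; exact: connect_slice.
    have {}db : d = b by case: (d) (b) db => [] [].
    have [|y yS xy] := attach x; first by rewrite -db.
    by rewrite db; apply: connect_trans xy (connect_slice _ _ _).
  have {}small d : #|slice d S| < k.
    by rewrite ltnNge; apply: contra small => ?; apply/existsP; exists d.
  (* A matching edge is destroyed when one of its ends is deleted, so at most [#|S|] of the [2 ^ n]
     edges are lost. *)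
  have /subsetPn[z _] : ~~ ([set: vert n] \subset
      slice false S :|: flip c @^-1: slice true S).
    apply: contraL S_lt => /subset_leq_card; rewrite cardsT -leqNgt => le.
    apply: leq_trans le _; rewrite (card_slices false) /=.
    apply: leq_trans (leq_card_setU _ _) _.
    by rewrite leq_add2l card_preimset //; exact: inv_inj (flipK c).
  rewrite !inE negb_or => /andP[z0 z1].
  have {}z0 : z \notin slice false S by rewrite inE.
  have {}z1 : flip c z \notin slice true S by rewrite inE.
  exists false, z => // -[] x xS; last exact: connect_slice.
  apply: connect_trans (connect_slice (small _) xS z1) _.
  by rewrite avoid_sym (@connect_cross false).
case/tupleP => d x; case/tupleP => e y; rewrite !in_setC => xS yS.
apply: connect_trans (all_z d x _) _; first by rewrite inE.
by rewrite avoid_sym all_z // inE.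
Qed.

End Doubling.

(** At most [k] vertices are deleted, so if one copy loses [k] of them the other is intact, and
    every survivor crosses by its matching edge. *)
Lemma joinG_connected n k c (H0 H1 : sgraph (vert n)) :
  0 < k -> k_connected k H0 -> k_connected k H1 ->
  k_connected k.+1 (joinG c H0 H1).
Proof.
move=> k_gt0 H0k H1k; have k_lt := H0k.1.
split=> [|S]; first by move: k_lt; rewrite !card_vert expnS; lia.
rewrite ltnS => S_le; set H := fun b : bool => if b then H1 else H0.
apply: (@doubling_connected n k c H) => [||||b Sb].
- by case.
- by move=> b x y; rewrite joinG_cons eqxx.
- by move=> b x; rewrite joinG_cons; case: b; rewrite /= eqxx.
- exact: leq_ltn_trans S_le k_lt.
have S'0 : #|slice (~~ b) S| = 0 by move: S_le; rewrite (card_slices b S); lia.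
split=> [|x xS]; first by rewrite S'0.
have S'n y : y \notin slice (~~ b) S by rewrite (cards0_eq S'0) inE.
exists (flip c x) => //; apply: connect_cross => // d y.
by rewrite joinG_cons; case: d; rewrite /= eqxx.
Qed.

(* If k of the at most k + 1 deleted vertices lie in one copy, at most one lies
   in the other, so a vertex can lose all its neighbours in that other copy only
   if it is u or v and has a single one; it then has k + 1 neighbours in its own
   copy, and any one that survives is joined to the other copy. *)
Lemma near_double_connected n k (H0 H1 : sgraph (vert n))
    (G : sgraph (vert n.+1)) (u v : vert n) :
  0 < n -> 1 < k -> k.+1 < #|{: vert n}| ->
  k_connected k H0 -> k_connected k H1 -> regular k.+2 G ->
  subrel (joinG true H0 H1) G ->
  (forall b x, x \notin [:: u; v] ->
     G (cons_tuple b x) (cons_tuple (~~ b) x)) ->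
  (forall b x y, x \in [:: u; v] ->
     G (cons_tuple b x) (cons_tuple (~~ b) y) -> y = flip true x) ->
  k_connected k.+2 G.
Proof.
move=> n_gt0 k_gt1 k_lt H0k H1k Gk joinGG Gcross Guv.
split=> [|S]; first by move: k_lt; rewrite !card_vert expnS; lia.
rewrite ltnS => S_le; set H := fun b : bool => if b then H1 else H0.
have GH b x y : H b x y -> G (cons_tuple b x) (cons_tuple b y).
  by move=> xy; apply: joinGG; rewrite joinG_cons eqxx.
have Gflip b x : G (cons_tuple b x) (cons_tuple (~~ b) (flip true x)).
  by apply: joinGG; rewrite joinG_cons; case: b; rewrite /= eqxx.
apply: (@doubling_connected n k true H) => //; first by case.
  exact: leq_ltn_trans S_le k_lt.
move=> b Sb; have S'1 : #|slice (~~ b) S| <= 1.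
  by move: S_le; rewrite (card_slices b S); lia.
split=> [|x xS]; first exact: leq_ltn_trans k_gt1.
have [fxS|fxS] := boolP (flip true x \in slice (~~ b) S); last first.
  by exists (flip true x) => //; exact: connect_cross.
have S'_gt0 : 0 < #|slice (~~ b) S|.
  by rewrite card_gt0; apply/set0Pn; exists (flip true x).
have S'E y : y \in slice (~~ b) S -> y = flip true x.
  have /eqP/cards1P[w S'w] : #|slice (~~ b) S| = 1.
    by apply/eqP; rewrite eqn_leq S'1 S'_gt0.
  by move: fxS; rewrite S'w !inE => /eqP-> /eqP.
have [xuv|xuv] := boolP (x \in [:: u; v]); last first.
  have xS' : x \notin slice (~~ b) S.
    by apply/negP=> /S'E/eqP; rewrite eq_sym (negPf (flip_true_neq _ _)).
  exists x => //; apply: connect1 => /=.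
  by move: xS xS'; rewrite !inE => -> ->; exact: Gcross.
have [y yS xy] : exists2 y, y \notin slice b S &
    G (cons_tuple b x) (cons_tuple b y).
  (* The deleted partner of [x] and the deleted vertices in the copy of [x] number at most [k.+1],
     while [x] has [k.+2] neighbours. *)
  have : ~~ ([set z | G (cons_tuple b x) z] \subset
      cons_tuple (~~ b) (flip true x) |: cons_tuple b @: slice b S).
    apply: contraTN S_le => /subset_leq_card; rewrite Gk cardsU1.
    rewrite (card_slices b S).
    rewrite card_imset; last exact: cons_inj.
    move: S'_gt0; case: (_ \notin _); lia.
  case/subsetPn; case/tupleP => d y; rewrite !inE => xy.
  have [db|db] := eqVneq d b.
    rewrite db in xy *; rewrite negb_or => /andP[_ yS]; exists y => //.
    by apply: contra yS => yS; apply: imset_f.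
  have {}db : d = ~~ b by case: (d) (b) db => [] [].
  rewrite db in xy *.
  by rewrite (Guv _ _ _ xuv xy) eqxx.
(* The only vertex deleted in the other copy is the partner of [x], and [y] differs from [x], so the
   partner of [y] survives. *)
exists (flip true y).
  apply/negP=> /S'E/(inv_inj (flipK true)) yx.
  by move: xy; rewrite yx edge_irrefl.
apply: (@connect_trans _ _ (cons_tuple b y)).
  by apply: connect1; move: xS yS; rewrite /= !inE => -> ->.
apply: connect_cross => //; apply/negP=> /S'E/(inv_inj (flipK true)) yx.
by move: xy; rewrite yx edge_irrefl.
Qed.

(** * Reflected Hamiltonian cycles *)

Lemma AQ_cons n b d (x y : vert n) : 0 < n ->
  AQ n.+1 (cons_tuple b x) (cons_tuple d y) =
    if b == d then AQ n x y else (y == x) || (y == flip true x).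
Proof.
case: n x y => // n x y _; rewrite /edge /= !theadE !behead_cons.
by case: eqP.
Qed.

Lemma AQ_regular n : 0 < n -> regular (2 * n - 1) (AQ n).
Proof.
elim: n => // -[_ _ x|n IHn _].
  rewrite (_ : [set y | AQ 1 x y] = [set~ x]) ?cardsC1 ?card_vert //.
  by apply/setP=> y; rewrite !inE eq_sym.
case/tupleP => b x; have := flip_true_neq x (ltn0Sn n).
set x' := flip true x => x'x.
have -> : [set y | AQ n.+2 (cons_tuple b x) y] = cons_tuple (~~ b) x |:
    (cons_tuple (~~ b) x' |: cons_tuple b @: [set y | AQ n.+1 x y]).
  apply/setP; case/tupleP => d y; rewrite !inE AQ_cons // !cons_eq.
  case: (eqVneq b d) => [<-|bd].
    rewrite mem_imset ?inE; last exact: cons_inj.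
    by case: (b).
  have -> : d = ~~ b by case: (b) (d) bd => [] [].
  rewrite eqxx /= orbA; apply/esym/orb_idr => /imsetP[z _ /eqP].
  by rewrite cons_eq; case: (b).
have notin z : cons_tuple (~~ b) z \notin cons_tuple b @: [set y | AQ n.+1 x y].
  by apply/imsetP=> -[w _ /eqP]; rewrite cons_eq; case: (b).
rewrite !cardsU1 !inE cons_eq eqxx (eq_sym x) (negPf x'x) /= !notin.
rewrite card_imset ?IHn //; last exact: cons_inj.
lia.
Qed.

Definition coAQ n (s : seq (vert n)) := diffG (AQ n) (cycleG s).

Section Reflect.
Variables (n : nat) (u : vert n) (s t : seq (vert n)).
Hypothesis last_st : last u s = last u t.

(** The copies may carry different cycles. It is enough that these agree in their first and last
    vertices, since the reflected cycle crosses exactly there. *)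
Definition reflected (s t : seq (vert n)) :=
  map (cons_tuple false) s ++ map (cons_tuple true) (rev t).

Lemma cycle_reflected (e : rel (vert n.+1)) : symmetric e ->
  cycle e (reflected (u :: s) (u :: t)) =
  [&& path (relpre (cons_tuple false) e) u s,
      e (cons_tuple false (last u s)) (cons_tuple true (last u s)),
      path (relpre (cons_tuple true) e) u t &
      e (cons_tuple false u) (cons_tuple true u)].
Proof.
move=> e_sym; rewrite /reflected /= rcons_cat cat_path path_map last_map.
rewrite last_st; congr andb; rewrite lastI rev_rcons /=; congr andb.
rewrite rcons_path path_map rev_path last_map andbC e_sym.
have -> : last (last u t) (rev (belast u t)) = u.
  by case: (t) => //= y p; rewrite rev_cons last_rcons.
by rewrite andbC; congr andb; apply: eq_path => x y /=; rewrite e_sym.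
Qed.

Hypotheses (Us : uniq (u :: s)) (Ut : uniq (u :: t)).
Hypotheses (sT : forall x, x \in u :: s) (tT : forall x, x \in u :: t).

Lemma reflected_uniq : uniq (reflected (u :: s) (u :: t)).
Proof. by rewrite uniq_join Us rev_uniq. Qed.

Lemma mem_reflected x : x \in reflected (u :: s) (u :: t).
Proof.
case/tupleP: x => b x; rewrite mem_cat; apply/orP.
by case: b; [right | left]; rewrite map_f ?mem_rev.
Qed.

Lemma cycleG_reflected b d x y : 1 < size s -> 1 < size t ->
  cycleG (reflected (u :: s) (u :: t)) (cons_tuple b x) (cons_tuple d y) ->
  if b == d then cycleG (if b then u :: t else u :: s) x y
  else (y == x) && (x \in [:: u; last u s]).
Proof.
move=> s_gt1 t_gt1.
(* [e] is the conclusion read as a symmetric relation. By [cycleG_sub] it then suffices that the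
   reflected sequence is a cycle for [e]. *)
pose e : rel (vert n.+1) := fun x y =>
  if thead x == thead y
  then cycleG (if thead x then u :: t else u :: s)
         (behead_tuple x) (behead_tuple y)
  else (behead_tuple y == behead_tuple x)
         && (behead_tuple x \in [:: u; last u s]).
have e_cons d1 x1 d2 x2 : e (cons_tuple d1 x1) (cons_tuple d2 x2) =
    if d1 == d2 then cycleG (if d1 then u :: t else u :: s) x1 x2
    else (x2 == x1) && (x1 \in [:: u; last u s]).
  by rewrite /e !theadE !behead_cons.
have e_sym : symmetric e.
  move=> {}x {}y; rewrite /e [thead y == _]eq_sym.
  case: eqP => [->|_]; first by rewrite edge_sym.
  by rewrite [behead_tuple x == _]eq_sym; case: eqP => // ->.
have cyc p : uniq (u :: p) -> (forall x, x \in u :: p) -> 1 < size p ->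
    path (cycleG (u :: p)) u p.
  move=> Up pT p_gt1; have := cycleG_cycle Up pT p_gt1.
  by rewrite /= rcons_path => /andP[].
rewrite -e_cons; apply: cycleG_sub => //; last exact: mem_reflected.
rewrite cycle_reflected // !e_cons !eqxx !inE !eqxx orbT !andbT.
rewrite (eq_path (e' := cycleG (u :: s))) ?cyc //; last first.
  by move=> p q; rewrite /= e_cons.
rewrite (eq_path (e' := cycleG (u :: t))) ?cyc // => p q.
by rewrite /= e_cons.
Qed.

Lemma reflected_cycleG x : 0 < size s -> x \in [:: u; last u s] ->
  cycleG (reflected (u :: s) (u :: t)) (cons_tuple false x) (cons_tuple true x).
Proof.
move=> s_gt0; have size_gt2 : 2 < size (reflected (u :: s) (u :: t)).
  rewrite size_cat !size_map size_rev /=; lia.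
have := cycleG_cycle reflected_uniq mem_reflected size_gt2.
rewrite cycle_reflected; last exact: edge_sym.
by case/and4P=> _ ? _ ?; rewrite !inE => /orP[]/eqP->.
Qed.

End Reflect.

(** * Paths and cycles of all lengths in the join of C and C' *)

Lemma ladder_length l m :
  odd l && (7 <= l) || (10 <= l) -> l <= 2 * m.+4 ->
  (exists2 q, 0 < q <= m.+1 & l = q.*2 + 5) \/
  (exists2 q, 0 < q <= m & l = q.*2 + 8).
Proof.
move=> l_ge l_le; have [lodd|leven] := boolP (odd l); [left | right].
  by exists (l - 5)./2; lia.
by exists (l - 8)./2; lia.
Qed.

Section Ladder.
Variables (n : nat) (H0 H1 : sgraph (vert n)).
Variables (a b c d : vert n) (r : seq (vert n)).
Let G := joinG false H0 H1.
Hypothesis Us : uniq [:: a, b, c, d & r].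
Hypothesis card_s : #|{: vert n}| = size [:: a, b, c, d & r].
Hypothesis r_ge4 : 4 <= size r.
Hypothesis cycle0 : cycle H0 [:: a, b, c, d & r].
Hypothesis cycle1 : cycle H1 [:: a, c, b, d & r].

Let G_cross b' x : G (cons_tuple b' x) (cons_tuple (~~ b') x).
Proof. by rewrite joinG_cons flip_false eqxx; case: b'. Qed.

Let G0 x y : G (cons_tuple false x) (cons_tuple false y) = H0 x y.
Proof. by rewrite joinG_cons. Qed.

Let G1 x y : G (cons_tuple true x) (cons_tuple true y) = H1 x y.
Proof. by rewrite joinG_cons. Qed.

(* From a backwards along the first cycle to h, across, and then forwards along
   the second cycle, through a and c to b. *)
Let detour h q := map (cons_tuple false) (rev (h :: q))
  ++ map (cons_tuple true) ((h :: q) ++ [:: a; c; b]).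

Let detour_path p h q : d :: r = p ++ h :: q ->
  path G (cons_tuple false a) (detour h q).
Proof.
move=> def_dr; move: cycle0 cycle1.
move=> /= /and4P[_ _ cd dr0] /and4P[ac cb bd dr1].
have hqa (H : sgraph (vert n)) x :
    H x d -> path H d (rcons r a) -> path H h (rcons q a).
  move=> xd dra; have : path H x (rcons (d :: r) a) by rewrite /= xd.
  by rewrite def_dr rcons_cat cat_path => /andP[_ /=/andP[]].
have hqa0 := hqa _ _ cd dr0; have hqa1 := hqa _ _ bd dr1.
rewrite cat_path path_copy last_map rev_cons last_rcons /=.
rewrite -rev_cons (G_cross false) path_copy -cat_rcons.
rewrite cat_path hqa1 last_rcons /=.
rewrite ac cb !andbT.
suff: path H0 (last h (rcons q a)) (rev (belast h (rcons q a))).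
  by rewrite last_rcons belast_rcons.
by rewrite rev_path (eq_path (e' := H0)) // => x y; rewrite edge_sym.
Qed.

Let detour_last x h q : last x (detour h q) = cons_tuple true b.
Proof. by rewrite /detour map_cat catA last_cat. Qed.

Let detour_size h q : size (detour h q) = (size (h :: q)).*2 + 3.
Proof. by rewrite size_cat !size_map size_rev size_cat /=; lia. Qed.

Let uniq_sandwich (p q p' : seq (vert n)) :
  uniq (map (cons_tuple false) p ++ map (cons_tuple true) q
    ++ map (cons_tuple false) p') = uniq (p ++ p') && uniq q.
Proof.
rewrite -uniq_join map_cat -catA; apply: perm_uniq.
by rewrite perm_cat2l perm_catC.
Qed.

Let distinct : [&& a != b, a != c, a != d, b != c, b != d & c != d].
Proof.
move: Us; rewrite /= !inE !negb_or.
by case/and5P=> /and4P[-> -> -> _] /and3P[-> -> _] /andP[-> _] _ _.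
Qed.

Let notin_tail p h q : d :: r = p ++ h :: q ->
  [&& a \notin h :: q, b \notin h :: q, c \notin h :: q & uniq (h :: q)].
Proof.
move=> def_dr; move: Us.
rewrite -[[:: _, _, _ & _]]/([:: a; b; c] ++ d :: r) def_dr.
rewrite catA cat_uniq => /and3P[_ /hasPn abcN ->]; rewrite andbT.
by apply/and3P; split; apply/negP=> /abcN; rewrite mem_cat !inE eqxx ?orbT.
Qed.

(** The detour ends at the copy-1 vertex over [b], and the matching edge there finishes the path. *)
Let spath_odd p h q : d :: r = p ++ h :: q ->
  spath G (cons_tuple false a) (cons_tuple false b) ((size (h :: q)).*2 + 5).
Proof.
move=> def_dr; exists (detour h q ++ [:: cons_tuple false b]); split.
- rewrite cat_path (detour_path def_dr) detour_last /=.
  by rewrite (G_cross true).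
- by rewrite last_cat.
- rewrite -catA -cat_cons -[_ :: map _ _]/(map _ (a :: rev (h :: q))).
  rewrite (uniq_sandwich _ _ [:: b]) (uniq_catC (a :: _)) (uniq_catC (h :: q)).
  have /and4P[aN bN cN Uhq] := notin_tail def_dr.
  have /and4P[ab ac ad /andP[bc _]] := distinct.
  move: (h :: q) aN bN cN Uhq => w aN bN cN Uw.
  rewrite /= !inE !mem_rev !rev_uniq !negb_or aN bN cN Uw ab ac.
  by rewrite (eq_sym b a) ab (eq_sym c) bc.
- by rewrite /= size_cat detour_size -addnA -addnS.
Qed.

(** After the detour, continue from [b] to [d] in copy 1, cross there, and return through [c] to [b]
    in copy 0. The three extra vertices change the parity; the segment [h :: q] has to avoid [d],
    hence it is taken inside [r]. *)
Let spath_even p h q : d :: r = d :: p ++ h :: q ->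
  spath G (cons_tuple false a) (cons_tuple false b) ((size (h :: q)).*2 + 8).
Proof.
move=> def_dr; have def_dr' : d :: r = (d :: p) ++ h :: q by [].
move: (cycle0) (cycle1) => /= /and4P[ab bc cd dr0] /and4P[ac cb bd dr1].
exists (detour h q ++ [:: cons_tuple true d; cons_tuple false d;
  cons_tuple false c; cons_tuple false b]); split.
- rewrite cat_path (detour_path def_dr') detour_last /=.
  rewrite G1 bd (G_cross true) !G0.
  by rewrite !(edge_sym H0 _ c) (edge_sym H0 c b) cd bc.
- by rewrite last_cat.
- rewrite -[[:: _, _ & _]]/(map (cons_tuple true) [:: d] ++
    map (cons_tuple false) [:: d; c; b]).
  rewrite /detour -!catA (catA (map (cons_tuple true) _)) -map_cat -catA.
  rewrite -cat_cons -[_ :: map _ _]/(map _ (a :: rev (h :: q))) uniq_sandwich.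
  rewrite (uniq_catC (a :: _)) (uniq_catC (h :: q)).
  have /and4P[aN bN cN _] := notin_tail def_dr'.
  have dN : d \notin h :: q.
    move: Us; rewrite -[[:: _, _, _ & _]]/([:: a; b; c] ++ d :: r) def_dr.
    rewrite cat_uniq => /and3P[_ _ /=].
    by rewrite mem_cat negb_or => /andP[/andP[]].
  have Uhq : uniq (h :: q) by case/and4P: (notin_tail def_dr').
  have /and5P[ab' ac' ad' bc' /andP[bd' cd']] := distinct.
  move: (h :: q) aN bN cN dN Uhq => w aN bN cN dN Uw.
  rewrite /= !inE !mem_rev !rev_uniq !negb_or aN bN cN dN Uw ab' ac' ad' bd'.
  rewrite (eq_sym d a) (eq_sym b a) (eq_sym c a) (eq_sym c b) (eq_sym d b).
  by rewrite (eq_sym d c) ab' ac' ad' bc' bd' cd'.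
- by rewrite /= size_cat detour_size -addnA -addnS.
Qed.

Lemma ladder_spath l :
  odd l && (7 <= l) || (10 <= l) -> l <= #|{: vert n.+1}| ->
  spath G (cons_tuple false a) (cons_tuple false b) l.
Proof.
rewrite card_vert expnS -card_vert card_s => l_ge /(ladder_length l_ge).
have split_seq (w : seq (vert n)) m : 0 < m <= size w ->
    exists p, exists h, exists2 q, size (h :: q) = m & w = p ++ h :: q.
  move=> /andP[m_gt0 m_le]; exists (take (size w - m) w).
  have := size_drop (size w - m) w; rewrite subKn //.
  case dropE: (drop _ _) => [|h q] sz_m; first by rewrite -sz_m in m_gt0.
  by exists h, q => //; rewrite -dropE cat_take_drop.
(* [m] is the number of vertices in the final segment traversed in both copies: a segment of
   [d :: r] for odd length, of [r] for even length. *)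
case=> -[m m_bd ->].
  have [p [h [q <- def_dr]]] := split_seq (d :: r) m m_bd.
  exact: spath_odd def_dr.
have [p [h [q <- def_r]]] := split_seq r m m_bd.
by apply: (@spath_even p); rewrite def_r.
Qed.

Lemma ladder_long : long_paths G (cons_tuple false a) (cons_tuple false b).
Proof.
split=> [|l l_gt l_le]; first by rewrite G0; case/andP: (cycle0).
apply: ladder_spath => //; move: l_gt r_ge4.
rewrite card_vert expnS -card_vert card_s /= => l_gt r_gt.
(* The join has at least 16 vertices, so [l] is at least 9, and 9 is odd. *)
have [l10|l_lt] := leqP 10 l; first exact: orbT.
suff -> : l = 9 by [].
by move: (size r) l_gt r_gt l_lt; clear=> *; lia.
Qed.

Lemma ladder_pancyclic : pancyclic 4 G.
Proof.
move=> l /andP[l_ge4 l_le].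
have [ab _] := ladder_long.
have [l_big|] := boolP (odd l && (7 <= l) || (10 <= l)).
  by apply: spath_cycle ab (ltnW l_ge4) (ladder_spath l_big l_le).
move=> l_small; have {l_ge4 l_le l_small} : l \in [:: 4; 5; 6; 8].
  by case: l l_ge4 l_small {l_le}; do 9!case=> //; move=> l _; rewrite orbT.
move: r_ge4 Us (cycle0) (cycle1).
case: r => [|e [|f [|g [|h r']]]] // _ U.
move=> /andP[_ /andP[bc0 /andP[cd0 /andP[de0 /andP[ef0 /andP[fg0 _]]]]]].
move=> /andP[_ /andP[_ /andP[bd1 /andP[de1 /andP[ef1 /andP[fg1 _]]]]]].
(* The lengths left over come from short arcs with common ends. The arc [d e f g] is shared by both
   cycles and gives 4, 6 and 8; the arc [b c d] of the first cycle against the edge [b d] of the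
   second gives 5. *)
have rungs x y m m' : spath H0 x y m -> spath H1 x y m' -> 3 <= m + m' ->
    has_cycle G (m + m').
  move=> H0xy H1xy m_ge3; have := @spath_join _ false H0 H1 x y m m' H0xy.
  rewrite !flip_false => /(_ H1xy).
  exact: (spath_cycle (G_cross false x) m_ge3).
have bcd : spath H0 b d 3.
  exists [:: c; d].
  by split; [rewrite /= bc0 cd0 | | exact: (take_uniq 3 (drop_uniq 1 U)) |].
have path_def (H : sgraph (vert n)) : H d e -> H e f -> spath H d f 3.
  move=> de ef; exists [:: e; f].
  by split; rewrite /= ?de ?ef //; exact: (take_uniq 3 (drop_uniq 3 U)).
have path_defg (H : sgraph (vert n)) : H d e -> H e f -> H f g -> spath H d g 4.
  move=> de ef fg; exists [:: e; f; g].
  by split; rewrite /= ?de ?ef ?fg //; exact: (take_uniq 4 (drop_uniq 3 U)).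
rewrite !inE => /or4P[]/eqP->.
- exact: (rungs d e 2 2 (spath_edge de0) (spath_edge de1)).
- exact: (rungs b d 3 2 bcd (spath_edge bd1)).
- exact: (rungs d f 3 3 (path_def _ de0 ef0) (path_def _ de1 ef1)).
- exact: (rungs d g 4 4 (path_defg _ de0 ef0 fg0) (path_defg _ de1 ef1 fg1)).
Qed.

End Ladder.

(** * Complements of the reflected cycles *)

Lemma size_spanning n (s : seq (vert n)) :
  uniq s -> (forall x, x \in s) -> size s = 2 ^ n.
Proof.
move=> Us sT; rewrite -(card_uniqP Us) -card_vert.
by apply: eq_card => x; rewrite sT.
Qed.

Lemma double_lt_expn n : 0 < n -> 2 * n - 2 < 2 ^ n.
Proof.
by case: n => // n _; rewrite expnS; have := ltn_expl n (ltnSn 1); lia.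
Qed.

Lemma coAQ_regular n (s : seq (vert n)) :
  1 < n -> uniq s -> (forall x, x \in s) -> cycle (AQ n) s ->
  regular (2 * n - 3) (coAQ s).
Proof.
move=> n_gt1 Us sT cs; rewrite (_ : 2 * n - 3 = 2 * n - 1 - 2); last by lia.
have s_gt2 : 2 < size s.
  rewrite (size_spanning Us sT) (@leq_trans (2 ^ 2)) //.
  by rewrite leq_exp2l.
apply: diffG_regular.
- by apply: cycleG_sub => //; exact: edge_sym.
- by apply: AQ_regular; exact: ltnW.
- exact: cycleG_regular.
Qed.

Section ReflectedComplement.
Variables (n : nat) (u : vert n) (s t : seq (vert n)).
Hypotheses (n_gt2 : 2 < n) (last_st : last u s = last u t).
Hypotheses (Us : uniq (u :: s)) (Ut : uniq (u :: t)).
Hypotheses (sT : forall x, x \in u :: s) (tT : forall x, x \in u :: t).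
Hypotheses (cycle_s : cycle (AQ n) (u :: s)) (cycle_t : cycle (AQ n) (u :: t)).
Let H0 := coAQ (u :: s).
Let H1 := coAQ (u :: t).
Let n_gt0 : 0 < n. Proof. exact: ltn_trans n_gt2. Qed.

Let size_gt1 (p : seq (vert n)) :
  uniq (u :: p) -> (forall x, x \in u :: p) -> 1 < size p.
Proof.
move=> Up pT; rewrite -ltnS -[(size p).+1]/(size (u :: p)).
rewrite (size_spanning Up pT) (@leq_trans (2 ^ 2)) //.
by rewrite leq_exp2l // ltnW.
Qed.

Let cyc_reflected b d x y := @cycleG_reflected n u s t last_st Us Ut sT tT
  b d x y (size_gt1 Us sT) (size_gt1 Ut tT).

Lemma cycle_AQ_reflected : cycle (AQ n.+1) (reflected (u :: s) (u :: t)).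
Proof.
rewrite cycle_reflected //; last exact: edge_sym.
have AQ_copy b p : cycle (AQ n) (u :: p) ->
    path (relpre (cons_tuple b) (AQ n.+1)) u p.
  rewrite /= rcons_path => /andP[up _].
  by rewrite (eq_path (e' := AQ n)) // => x y; rewrite /= AQ_cons // eqxx.
by rewrite !AQ_copy // !AQ_cons //= !eqxx.
Qed.

(** The reflected cycle crosses between the copies only along the identity matching, so the whole
    complementation matching stays in its complement. *)
Lemma coAQ_reflected :
  subrel (joinG true H0 H1) (coAQ (reflected (u :: s) (u :: t))).
Proof.
case/tupleP => b x; case/tupleP => d y; rewrite joinG_cons => xy.
have not_cyc := contra (@cyc_reflected b d x y).
rewrite /coAQ /edge /= AQ_cons //; move: xy not_cyc; case: eqP => [<-|bd].
  by case: (b) => /andP[-> /= xy]; apply.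
move=> /eqP-> not_cyc; rewrite eqxx orbT /=; apply: not_cyc.
by rewrite (negPf (flip_true_neq _ _)).
Qed.

Lemma coAQ_reflected_connected :
  k_connected (2 * n - 3) H0 -> k_connected (2 * n - 3) H1 ->
  k_connected (2 * n.+1 - 3) (coAQ (reflected (u :: s) (u :: t))).
Proof.
move=> H0k H1k; have -> : 2 * n.+1 - 3 = (2 * n - 3).+2 by lia.
(* The exceptional vertices are the two common ends, where the reflected cycle uses up the edge of
   the identity matching. *)
apply: (@near_double_connected n _ H0 H1 _ u (last u s)) => //.
- by lia.
- rewrite card_vert; apply: leq_ltn_trans (double_lt_expn n_gt0); lia.
- have -> : (2 * n - 3).+2 = 2 * n.+1 - 3 by lia.
  apply: coAQ_regular => //; first exact: reflected_uniq.
    exact: mem_reflected.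
  exact: cycle_AQ_reflected.
- exact: coAQ_reflected.
- move=> b x xuv.
  have not_cyc := contra (@cyc_reflected b (~~ b) x x).
  rewrite /coAQ /edge /= AQ_cons //; move: not_cyc.
  by rewrite eqxx (negPf xuv) /= => ->; case: (b).
- move=> b x y xuv; rewrite /coAQ /edge /= AQ_cons //.
  have := reflected_cycleG last_st Us Ut sT tT (ltnW (size_gt1 Us sT)) xuv.
  rewrite edge_sym; case: b => /= cyc; last rewrite edge_sym in cyc;
    by case/andP=> /orP[]/eqP-> //; rewrite cyc.
Qed.

End ReflectedComplement.

(** * The base case in [AQ 3], by computation *)

Section SmallConnectivity.
Variables (T : finType) (G : sgraph T) (vs : seq T).
Hypothesis vsT : forall x, x \in vs.

Definition grow (ws A : seq T) :=
  [seq y <- ws | (y \in A) || has (fun x => G x y) A].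

(** A search of [m] rounds from the first surviving vertex, done on lists so that it evaluates. Too
    small an [m] can only make the test fail. *)
Definition linked m (ds : seq T) :=
  let ws := [seq y <- vs | y \notin ds] in
  all [in iter m (grow ws) (take 1 ws)] ws.

Lemma linkedP m (ds : seq T) (S : {set T}) :
  S =i ds -> linked m ds -> connected_in G (~: S).
Proof.
move=> Sds; rewrite /linked; set ws := [seq y <- vs | _] => /allP link.
have wsE y : (y \in ws) = (y \in ~: S).
  by rewrite mem_filter vsT andbT inE Sds.
case def_ws: ws => [|x ws'] in link; first by move=> y z; rewrite -wsE def_ws.
suff reach y : y \in ~: S -> connect
    [rel u v | [&& u \in ~: S, v \in ~: S & G u v]] x y.
  move=> y z /reach xy /reach; apply: connect_trans.
  by rewrite avoid_sym.
rewrite -wsE def_ws => /link /=; rewrite take0 -def_ws.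
elim: m {link} y => [|m IHm] y /=; first by rewrite inE => /eqP->.
rewrite mem_filter => /andP[/orP[/IHm//|/hasP[w wA wy]] yS].
apply: connect_trans (IHm w wA) (connect1 _); rewrite /= -!wsE yS wy !andbT.
case: (m) wA => [|m'] /=; last by rewrite mem_filter => /andP[].
by rewrite inE => /eqP->; rewrite def_ws mem_head.
Qed.

Lemma linked3_connected m : 3 < #|T| ->
  linked m [::] && all (fun u => linked m [:: u] &&
    all (fun v => linked m [:: u; v]) vs) vs ->
  k_connected 3 G.
Proof.
move=> T_gt3 /andP[link0 /allP link]; split=> // S S_lt3.
have def_S : S =i enum S by move=> x; rewrite mem_enum.
move: S_lt3 def_S; rewrite cardE; case: (enum S) => [|u [|v [|]]] // _ def_S.
- exact: linkedP def_S link0.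
- by have /andP[+ _] := link u (vsT u); exact: linkedP.
- by have /andP[_ /allP/(_ v (vsT v))] := link u (vsT u); exact: linkedP.
Qed.

End SmallConnectivity.

(** The last three binary digits of [k], most significant first. *)
Definition word k : vert 3 := [tuple odd k./2./2; odd k./2; odd k].

Lemma word_spanning (s : seq (vert 3)) :
  all (fun k => word k \in s) (iota 0 8) -> forall x, x \in s.
Proof.
move/allP=> all_s x.
suff [k k8 ->] : exists2 k, k \in iota 0 8 & x = word k by exact: all_s.
case/tupleP: x => b1 x; case/tupleP: x => b2 x; case/tupleP: x => b3 x.
exists (b1 * 4 + b2 * 2 + b3); first by case: b1 b2 b3 => [] [] [].
by rewrite (tuple0 x); apply: val_inj; case: b1 b2 b3 => [] [] [].
Qed.

(* Found by search: both complements in AQ_3 are 3-connected and have long paths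
   between the antipodal vertices 000 and 111. *)
Definition cycle3 := map word [:: 0; 1; 2; 3; 7; 6; 5; 4].
Definition cycle3' := map word [:: 0; 2; 1; 3; 7; 6; 5; 4].

Lemma spathI (T : finType) (G : sgraph T) x y p :
  [&& path G x p, last x p == y & uniq (x :: p)] -> spath G x y (size p).+1.
Proof. by case/and3P=> xp /eqP lastp Up; exists p. Qed.

Lemma cycle3_spanning x : x \in cycle3.
Proof. by move: x; exact: word_spanning. Qed.

Lemma coAQ3_connected (s : seq (vert 3)) :
  linked (coAQ s) cycle3 4 [::] &&
  all (fun u => linked (coAQ s) cycle3 4 [:: u] &&
    all (fun v => linked (coAQ s) cycle3 4 [:: u; v]) cycle3) cycle3 ->
  k_connected 3 (coAQ s).
Proof. by apply: (linked3_connected cycle3_spanning); rewrite card_vert. Qed.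

(** The lists omit the starting vertex, so sizes 4 to 7 give the path lengths 5 to 8, the upper half
    for 8 vertices. *)
Lemma long_paths3 (s : seq (vert 3)) (p4 p5 p6 p7 : seq nat) :
  coAQ s (word 0) (word 7) ->
  all (fun p => [&& path (coAQ s) (word 0) (map word p),
      last (word 0) (map word p) == word 7 & uniq (map word (0 :: p))])
    [:: p4; p5; p6; p7] ->
  [:: size p4; size p5; size p6; size p7] = [:: 4; 5; 6; 7] ->
  long_paths (coAQ s) (word 0) (word 7).
Proof.
move=> K07 /and5P[K4 K5 K6 K7 _] [sz4 sz5 sz6 sz7]; split=> // l.
rewrite card_vert -[2 ^ 3]/8; do 5?[case: l => // l].
case: l => [|[|[|[|]]]] // _ _.
- by have := spathI K4; rewrite size_map sz4.
- by have := spathI K5; rewrite size_map sz5.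
- by have := spathI K6; rewrite size_map sz6.
- by have := spathI K7; rewrite size_map sz7.
Qed.

Lemma long_cycle3 : long_paths (coAQ cycle3) (word 0) (word 7).
Proof.
by apply: (@long_paths3 _ [:: 2; 6; 4; 7] [:: 2; 6; 1; 5; 7]
  [:: 2; 5; 1; 3; 4; 7] [:: 2; 6; 4; 3; 1; 5; 7]); vm_compute.
Qed.

Lemma long_cycle3' : long_paths (coAQ cycle3') (word 0) (word 7).
Proof.
by apply: (@long_paths3 _ [:: 1; 6; 4; 7] [:: 1; 6; 2; 5; 7]
  [:: 1; 5; 2; 3; 4; 7] [:: 1; 6; 4; 3; 2; 5; 7]); vm_compute.
Qed.

Lemma pancyclic_cycle3 : pancyclic 4 (coAQ cycle3).
Proof.
move=> l /andP[l_ge4 l_le]; have [K07 long] := long_cycle3.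
apply: spath_cycle K07 (ltnW l_ge4) _.
have [l_big|l_small] := ltnP #|{: vert 3}| l.*2; first exact: long.
(* Length 4 is the only one outside the upper half; a separate path closed by the edge from 000 to
   111 provides it. *)
have -> : l = 4 by move: l_ge4 l_small; rewrite card_vert; lia.
by apply: (@spathI _ _ _ _ (map word [:: 2; 5; 7])); vm_compute.
Qed.

(** The induction invariant for the pair C, C'. The long paths in both complements have the same
    antipodal ends, so that the two complements can be joined to each other; pancyclicity is
    recorded for C, whose complement becomes copy 0 and supplies the short cycles. *)
Record swap_pair n (a b c d : vert n) r : Prop := SwapPair {
  swap_uniq : uniq [:: a, b, c, d & r];
  swap_span : forall x, x \in [:: a, b, c, d & r];
  swap_cycle : cycle (AQ n) [:: a, b, c, d & r];
  swap_cycle' : cycle (AQ n) [:: a, c, b, d & r];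
  swap_connected : k_connected (2 * n - 3) (coAQ [:: a, b, c, d & r]);
  swap_connected' : k_connected (2 * n - 3) (coAQ [:: a, c, b, d & r]);
  swap_pancyclic : pancyclic 4 (coAQ [:: a, b, c, d & r]);
  swap_long : exists x, long_paths (coAQ [:: a, b, c, d & r]) x (flip true x)
    /\ long_paths (coAQ [:: a, c, b, d & r]) x (flip true x)
}.

Lemma swapped_uniq (T : eqType) (a b c d : T) r :
  uniq [:: a, b, c, d & r] -> uniq [:: a, c, b, d & r].
Proof.
rewrite (@perm_uniq _ [:: a, b, c, d & r] [:: a, c, b, d & r]) //.
by rewrite perm_cons -[[:: b, c & _]]/([:: b] ++ [:: c] ++ _) perm_catCA.
Qed.

Lemma swapped_mem (T : eqType) (a b c d : T) r x :
  (x \in [:: a, c, b, d & r]) = (x \in [:: a, b, c, d & r]).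
Proof. by rewrite !inE; congr orb; rewrite orbCA. Qed.

Lemma swap_pair3 : exists a b c d r, @swap_pair 3 a b c d r.
Proof.
exists (word 0), (word 1), (word 2), (word 3), (map word [:: 7; 6; 5; 4]).
have flip0 : flip true (word 0) = word 7 by exact: val_inj.
split.
- by vm_compute.
- exact: cycle3_spanning.
- by vm_compute.
- by vm_compute.
- by apply: coAQ3_connected; vm_compute.
- by apply: (@coAQ3_connected cycle3'); vm_compute.
- exact: pancyclic_cycle3.
exists (word 0); rewrite flip0.
by split; [exact: long_cycle3 | exact: long_cycle3'].
Qed.

(** The new ends, [x] in copy 0 and its complement in copy 1, are antipodal again, so the property
    passes from each dimension to the next. *)
Lemma joinG_long_antipodal n x (H0 H1 : sgraph (vert n)) : 1 < n ->
  long_paths H0 x (flip true x) -> long_paths H1 x (flip true x) ->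
  long_paths (joinG true H0 H1) (cons_tuple false x)
    (flip true (cons_tuple false x)).
Proof.
move=> n_gt1 long0 long1; rewrite flip_cons; apply: joinG_long long0 _ => //.
by rewrite flipK; exact: long_paths_sym.
Qed.

Lemma joinG_pancyclic_antipodal n x (H0 H1 : sgraph (vert n)) : 1 < n ->
  pancyclic 4 H0 -> long_paths H0 x (flip true x) ->
  long_paths H1 x (flip true x) -> pancyclic 4 (joinG true H0 H1).
Proof.
move=> n_gt1 pan0 long0 long1; apply: joinG_pancyclic n_gt1 pan0 long0 _.
by rewrite flipK; exact: long_paths_sym.
Qed.

(** Reflect C against C for the new first cycle, and C' against C for the second. With the same copy
    1, the two results again differ only by interchanging their second and third vertices. *)
Lemma swap_pairS n a b c d r : 2 < n -> @swap_pair n a b c d r ->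
  exists a' b' c' d' r', @swap_pair n.+1 a' b' c' d' r'.
Proof.
move=> n_gt2 [Us sT cs ct Ks Kt pan [x [long_s long_t]]].
set s := [:: a, b, c, d & r] in Us sT cs Ks pan long_s.
set t := [:: a, c, b, d & r] in ct Kt long_t.
have Ut : uniq t by exact: swapped_uniq.
have tT y : y \in t by rewrite swapped_mem.
have n_gt1 := ltnW n_gt2.
pose p := [:: b, c, d & r]; pose p' := [:: c, b, d & r].
exists (cons_tuple false a), (cons_tuple false b), (cons_tuple false c),
  (cons_tuple false d),
  (map (cons_tuple false) r ++ map (cons_tuple true) (rev s)).
split.
- exact: (@reflected_uniq _ a p p).
- exact: (@mem_reflected _ a p p).
- exact: (@cycle_AQ_reflected _ a p p).
- exact: (@cycle_AQ_reflected _ a p' p).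
- exact: (@coAQ_reflected_connected _ a p p n_gt2 erefl
    Us Us sT sT cs cs Ks Ks).
- exact: (@coAQ_reflected_connected _ a p' p n_gt2 erefl
    Ut Us tT sT ct cs Kt Ks).
- apply: (pancyclic_mono (@coAQ_reflected _ a p p
    n_gt2 erefl Us Us sT sT)).
  exact: (joinG_pancyclic_antipodal n_gt1 pan long_s long_s).
exists (cons_tuple false x); split.
  apply: (long_paths_mono (@coAQ_reflected _ a p p
    n_gt2 erefl Us Us sT sT)).
  exact: (joinG_long_antipodal n_gt1 long_s long_s).
apply: (long_paths_mono (@coAQ_reflected _ a p' p
  n_gt2 erefl Ut Us tT sT)).
exact: (joinG_long_antipodal n_gt1 long_t long_s).
Qed.

Lemma swap_pair_exists n : 2 < n -> exists a b c d r, @swap_pair n a b c d r.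
Proof.
elim: n => // n IHn; rewrite ltnS leq_eqVlt => /orP[/eqP<-|n_gt2].
  exact: swap_pair3.
have [a [b [c [d [r /swap_pairS pairS]]]]] := IHn n_gt2; exact: pairS.
Qed.

(** * Decompositions of all types *)

Lemma joinG_decomposition n (H0 H1 K0 K1 : sgraph (vert n)) : 0 < n ->
  decomposition2 (AQ n) H0 K0 -> decomposition2 (AQ n) H1 K1 ->
  decomposition2 (AQ n.+1) (joinG false H0 H1) (joinG true K0 K1).
Proof.
move=> n_gt0 [H0AQ K0AQ xor0] [H1AQ K1AQ xor1].
split; case/tupleP => b x; case/tupleP => d y;
  rewrite !joinG_cons AQ_cons //; case: (b == d).
- by case: b; [exact: H1AQ | exact: H0AQ].
- by rewrite flip_false => ->.
- by case: b; [exact: K1AQ | exact: K0AQ].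
- by move=> ->; rewrite orbT.
- by case: b; [exact: xor1 | exact: xor0].
rewrite flip_false => /orP[]/eqP->; last first.
  by rewrite eqxx (negPf (flip_true_neq _ _)).
by rewrite eqxx eq_sym (negPf (flip_true_neq _ _)).
Qed.

(** Here [k] is the smaller degree. Lowering [n] and [k] together ends at [k = 3], which is built
    from a swap pair one dimension lower; the long paths are carried along to keep the join
    pancyclic. *)
Lemma AQ_split n k : 2 < k < n ->
  exists H1 H2 : sgraph (vert n),
    [/\ decomposition2 (AQ n) H1 H2,
        [/\ regular k H1, k_connected k H1, pancyclic 4 H1
          & exists x y, long_paths H1 x y]
      & [/\ regular (2 * n - 1 - k) H2, k_connected (2 * n - 1 - k) H2,
            pancyclic 4 H2 & exists x, long_paths H2 x (flip true x)]].
Proof.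
elim: n k => [|n IHn] k; first by rewrite andbF.
case: k => // k /andP[]; rewrite !ltnS leq_eqVlt => /orP[/eqP<-|k_gt2] k_lt.
  have n_gt1 := ltnW k_lt; have n_gt0 := ltnW n_gt1.
  have degE : 2 * n.+1 - 1 - 3 = (2 * n - 3).+1 by lia.
  have deg_gt0 : 0 < 2 * n - 3 by lia.
  have [a [b [c [d [r]]]]] := swap_pair_exists k_lt.
  case=> [Us sT cs ct Ks Kt pan [x [long_s long_t]]].
  set s := [:: a, b, c, d & r] in Us sT cs Ks pan long_s.
  set t := [:: a, c, b, d & r] in ct Kt long_t.
  have Ut : uniq t by exact: swapped_uniq.
  have tT y : y \in t by rewrite swapped_mem.
  have size_s := size_spanning Us sT.
  have r_ge4 : 4 <= size r.
    suff: 2 ^ 3 <= size s by rewrite /= -[2 ^ 3]/(4 + 4) !ltnS.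
    by rewrite size_s leq_exp2l.
  have card_s : #|{: vert n}| = size s by rewrite card_vert size_s.
  have Hs : cycle (cycleG s) s by apply: cycleG_cycle.
  have Ht : cycle (cycleG t) t by apply: cycleG_cycle.
  have dec (q : seq (vert n)) : (forall x, x \in q) -> cycle (AQ n) q ->
      decomposition2 (AQ n) (cycleG q) (coAQ q).
    move=> qT cq; apply: diffG_decomposition.
    by apply: cycleG_sub => //; exact: edge_sym.
  exists (joinG false (cycleG s) (cycleG t)), (joinG true (coAQ s) (coAQ t)).
  rewrite degE; split; first by apply: joinG_decomposition => //; exact: dec.
    split; [|apply: joinG_connected => // | |].
    - by apply: joinG_regular; apply: cycleG_regular.
    - by apply: cycleG_connected.
    - by apply: cycleG_connected.
    - exact: (ladder_pancyclic Us card_s r_ge4 Hs Ht).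
    exists (cons_tuple false a), (cons_tuple false b).
    exact: (ladder_long Us card_s r_ge4 Hs Ht).
  split.
  - by apply: joinG_regular; apply: coAQ_regular.
  - exact: (joinG_connected true deg_gt0 Ks Kt).
  - exact: (joinG_pancyclic_antipodal n_gt1 pan long_s long_t).
  exists (cons_tuple false x).
  exact: (joinG_long_antipodal n_gt1 long_s long_t).
have n_gt1 : 1 < n by lia.
have [|H1 [H2 [dec]]] := IHn k; first by rewrite k_gt2.
case=> reg1 con1 pan1 [x [y long1]] [reg2 con2 pan2 [z long2]].
have -> : 2 * n.+1 - 1 - k.+1 = (2 * n - 1 - k).+1 by lia.
exists (joinG false H1 H1), (joinG true H2 H2).
have long1' : long_paths H1 (flip false x) (flip false y).
  by rewrite !flip_false.
split; first by apply: joinG_decomposition => //; exact: ltnW.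
  split.
  - exact: joinG_regular.
  - by apply: joinG_connected => //; exact: ltn_trans k_gt2.
  - exact: joinG_pancyclic long1 long1'.
  exists (cons_tuple false x), (cons_tuple true (flip false x)).
  exact: joinG_long long1 long1'.
split.
- exact: joinG_regular.
- by apply: joinG_connected => //; lia.
- exact: (joinG_pancyclic_antipodal n_gt1 pan2 long2 long2).
by exists (cons_tuple false z); exact: (joinG_long_antipodal n_gt1 long2 long2).
Qed.

Lemma decomposition2C (T : finType) (G H1 H2 : sgraph T) :
  decomposition2 G H1 H2 -> decomposition2 G H2 H1.
Proof. by case=> ? ? dec; split=> // x y /dec; rewrite addbC. Qed.

Theorem theorem1p2 (n n1 n2 : nat) (n_ge4 : 4 <= n)
    (n1_ge2 : 2 <= n1) (n2_ge2 : 2 <= n2) (n_sum : 2 * n - 1 = n1 + n2) :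
  exists H1 H2 : sgraph (n.-tuple bool),
    [/\ decomposition2 (AQ n) H1 H2,
        [/\ regular n1 H1, k_connected n1 H1 & 3 <= n1 -> pancyclic 4 H1]
      & [/\ regular n2 H2, k_connected n2 H2 & 3 <= n2 -> pancyclic 4 H2]].
Proof.
(* The sum [2 * n - 1] is odd, so the two degrees differ, and the smaller one is below [n]. *)
wlog le_n12 : n1 n2 n1_ge2 n2_ge2 n_sum / n1 < n2.
  move=> wlog_lt; have [|le_n21] := ltnP n1 n2; first exact: wlog_lt.
  have [||||H2 [H1 [dec ? ?]]] := wlog_lt n2 n1 => //; try lia.
  by exists H1, H2; split=> //; exact: decomposition2C.
have def_n2 : n2 = 2 * n - 1 - n1 by lia.
have [n1_gt2|n1_le2] := ltnP 2 n1.
  have [|H1 [H2 [dec [? ? ? _] [reg2 con2 ? _]]]] := @AQ_split n n1.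
    by lia.
  by exists H1, H2; split=> //; split=> //; rewrite def_n2.
have def_n1 : n1 = 2 by lia.
have -> : n2 = 2 * n - 3 by lia.
have n_gt2 : 2 < n by exact: ltnW.
have [a [b [c [d [r [Us sT cs _ Ks _ pan _]]]]]] := swap_pair_exists n_gt2.
(* Degree 2 is realised by the Hamiltonian cycle itself, for which the pancyclicity claim is
   vacuous. *)
exists (cycleG [:: a, b, c, d & r]), (coAQ [:: a, b, c, d & r]).
rewrite def_n1; split.
- by apply: diffG_decomposition; apply: cycleG_sub => //; exact: edge_sym.
- by split=> //; [exact: cycleG_regular | exact: cycleG_connected].
by split=> //; apply: coAQ_regular => //; exact: ltnW.
Qed.
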